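(* Let $R_\downarrow$ and $R_\uparrow$ be cumulative hazard functions such that, for some $x_0\in\mathbb{R}$, $R_\downarrow(x)\leq R_\uparrow(x)$ for all $x\geq x_0$, and let $\xi_1$ be an $R_\downarrow$-heavy random variable. Fix integers $n\geq 2$ and $1<k\leq n$. The following are equivalent: (i) There exist (on a suitable probability space) $R_\downarrow$-heavy random variables $\xi_2,\dots,\xi_n$, independent of $\xi_1$ and of each other (i.e. $\xi_1,\dots,\xi_n$ are mutually independent), such that for every $I\subseteq\{1,\dots,n\}$: $\min_{i\in I}\xi_i$ is $R_\uparrow$-light if $|I|=k$, and $\min_{i\in I}\xi_i$ is $R_\downarrow$-heavy if $|I|=k-1$. (ii) There exist $\gamma>0$ and an $(R_\downarrow,R_\uparrow)$-segmentation $s_1<t_1<s_2<t_2<\cdots$ such that $$\frac{R_{\xi_1}(x)}{R_\uparrow(x)}\geq\gamma\qquad\text{for all }x\in[s_i,t_i],\ i=1,2,\dots.$$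
   Context: A cumulative hazard function is a function $R:\mathbb{R}\to[0,\infty)$ that is nondecreasing, right-continuous, with $\lim_{x\to-\infty}R(x)=0$ and $\lim_{x\to\infty}R(x)=\infty$. For a real random variable $\xi$, its cumulative hazard is $R_\xi(x):=-\log\mathbb{P}(\xi>x)$. A random variable $\xi$ is right-unbounded if $\mathbb{P}(\xi>x)>0$ for all $x\in\mathbb{R}$. For a cumulative hazard function $R$, a right-unbounded random variable $\xi$ is $R$-heavy if $\liminf_{x\to\infty}R_\xi(x)/R(x)=0$, and $R$-light otherwise (i.e. if this liminf is positive). For $R_\downarrow,R_\uparrow$ as in the claim, an $(R_\downarrow,R_\uparrow)$-segmentation is a sequence of real numbers $s_1<t_1<s_2<t_2<\cdots$ such that $R_\downarrow(s_1)>1$ and $$\lim_{i\to\infty}\frac{R_\uparrow(s_i-0)}{R_\downarrow(t_i)}=0,$$ where $R_\uparrow(s-0)$ denotes the left limit of $R_\uparrow$ at $s$. The inequality $R_{\xi_1}(x)/R_\uparrow(x)\geq\gamma$ is understood to include that the quotient is defined, i.e. $R_\uparrow(x)>0$. ''On a suitable probability space'' means that the underlying probability space may be replaced by another one carrying a copy of $\xi_1$ with the same distribution. *)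

(* Defs.v *)
From HB Require Import structures.
From mathcomp Require Import all_boot all_order all_algebra.
From mathcomp Require Import all_classical all_reals all_analysis.
From mathcomp Require Import measurable_realfun.

Set Implicit Arguments.
Unset Strict Implicit.
Unset Printing Implicit Defensive.

Import Order.TTheory GRing.Theory Num.Theory.
Import numFieldNormedType.Exports.

Local Open Scope classical_set_scope.
Local Open Scope ring_scope.

Record cumulative_hazard (R : realType) (H : R -> R) : Prop := {
  cumulative_hazard_ge0 : forall x, 0 <= H x ;
  cumulative_hazard_nd : {homo H : x y / x <= y} ;
  cumulative_hazard_rc : right_continuous H ;
  cumulative_hazardNy : H x @[x --> -oo] --> 0 ;
  cumulative_hazardy : H x @[x --> +oo] --> +oo
}.

Section hazard.
Context (R : realType) (d : measure_display) (T : measurableType d).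
Context (P : probability T R).
Implicit Types (X : {RV P >-> R}) (H : R -> R).

(* extended-real valued: it is +oo where P(X > x) = 0 *)
Definition hazard X (x : R) : \bar R := (- lne (ccdf X x))%E.

Definition right_unbounded X : Prop :=
  forall x : R, (0 < P [set t | (x < X t)%R])%E.

(* H x = 0 only matters for x away from +oo, hence does not affect the limit *)
Definition liminf_hazard_ratio X H : \bar R :=
  limf_einf (fun x : R => (hazard X x / (H x)%:E)%E) (pinfty_nbhs R).

Definition heavy H X : Prop :=
  right_unbounded X /\ liminf_hazard_ratio X H = 0%E.

Definition light H X : Prop :=
  right_unbounded X /\ (0 < liminf_hazard_ratio X H)%E.

Definition mutually_independent (I : finType) (X : I -> {RV P >-> R}) : Prop :=
  forall (J : {set I}) (A : I -> set R), (forall i, measurable (A i)) ->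
    P (\bigcap_(i in [set` J]) (X i @^-1` A i)) =
    (\prod_(i in J) P (X i @^-1` A i))%E.

End hazard.

Section min_RV.
Context (R : realType) (d : measure_display) (T : measurableType d).
Context (P : probability T R) (I : finType).
Variables (X : I -> {RV P >-> R}) (J : {set I}).

(* the minimum over the empty family is +oo; fine is the identity on the
   (real) minimum over a nonempty J *)
Definition min_RV (t : T) : R := fine (\big[mine/+oo%E]_(i in J) (X i t)%:E).

Lemma measurable_min_RV : measurable_fun setT min_RV.
Proof.
apply: (measurableT_comp (fine_measurable measurableT)).
rewrite (_ : (fun t : T => _) =
  \big[(fun f g : T -> \bar R => fun t => mine (f t) (g t))/fun=> +oo%E]_(i in J)
    (fun t => (X i t)%:E)); last first.
  by apply/funext => t; elim/big_rec2 : _ => // i f y _ ->.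
elim/big_ind : _ => [|f g mf mg|i _].
- exact: measurable_cst.
- exact: measurable_mine.
- by apply/measurable_EFinP; exact: measurable_funPT.
Qed.

HB.instance Definition _ :=
  isMeasurableFun.Build _ _ T R min_RV measurable_min_RV.

End min_RV.

Definition left_limit (R : realType) (H : R -> R) (s : R) : R :=
  lim (H x @[x --> s^'-]).

(* s i and t i stand for s_(i+1) and t_(i+1) *)
Record segmentation (R : realType) (Hdown Hup : R -> R) (s t : nat -> R) :
    Prop := {
  segmentation_lt : forall i, s i < t i ;
  segmentation_ltS : forall i, t i < s i.+1 ;
  segmentation_gt1 : 1 < Hdown (s 0%N) ;
  segmentation_cvg : left_limit Hup (s i) / Hdown (t i) @[i --> \oo] --> 0
}.

(* Main.v *)
Require Import Defs.
From HB Require Import structures.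
From mathcomp Require Import all_boot all_order all_algebra.
From mathcomp Require Import all_classical all_reals all_analysis.
From mathcomp Require Import measurable_realfun.
From mathcomp Require Import lra.

(** Write [D] and [U] for [Hdown] and [Hup], and [R_i] for the cumulative
    hazard of [xi i].  Survival functions of independent variables multiply
    under minima, so the hazard of [min_(i in I) xi i] is [\sum_(i in I) R_i]
    ([real_hazard_min_RV]).  A variable is light when its hazard is eventually
    at least [g * H], and heavy when it is below [e * H] arbitrarily far out
    for every [e > 0] ([lightP], [heavyP]).  The theorem thus becomes a
    statement about nondecreasing functions.

    From the random variables to the segmentation ([segmentation_of_pair]).
    Choose [k - 1] indices [J] other than the first one and put
    [b := \sum_(j in J) R_j].  Lightness of the [k] variables gives
    [g * U <= R_1 + b], heaviness of those in [J] gives points [t] with [b t]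
    negligible before [D t], hence before [U t].  At such a [t], [R_1] alone
    carries [U].  Go left from [t] for as long as [R_1 >= (g / 2) * U], down to
    some [s]: at points arbitrarily close before [s] it is [b] that carries
    [U], and since [b] is nondecreasing, [U (s - 0)] is at most a constant times [b t], which is
    negligible before [D t].  This is a segment of the desired kind.

    From the segmentation to the random variables.  After thinning and a slight
    extension of the segments ([block_sequence_of_segmentation]) the line splits
    into blocks [s i, s i.+1[ made of a segment [s i, u i], on which [R_1]
    carries [U], and a gap, which contains a point [y i] where [R_1] is
    negligible before [D].  Every other [R_j] is [U], flattened on some
    intervals [s i, b i[ to the constant [U (s i - 0)] ([flatten]); at [t i]
    and at [y i] that constant is negligible before [D].  In block [i] a set
    [K i] of at most [k - 1] indices is made small at a common point: if it does
    not contain the first index, its hazards are kept flat on the segment; if it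
    does, its other hazards are kept flat on the whole block, and the common
    point is [y i].  In both cases at most [k - 1] hazards are small at any
    given point, so among any [k] of them one carries [U]
    ([flat_hazard_light]); letting [K] run infinitely often through all sets of
    fewer than [k] indices makes every such minimum heavy
    ([flat_hazard_heavy]).  Finally each cumulative hazard is the hazard of a
    probability law ([law_of_hazard]), and independent variables with given laws
    live on a product space ([independent_family]). *)

Import Order.TTheory GRing.Theory Num.Theory.
Import numFieldNormedType.Exports.

Local Open Scope classical_set_scope.
Local Open Scope ring_scope.

Set Implicit Arguments.
Unset Strict Implicit.
Unset Printing Implicit Defensive.

(** * Real-valued hazards, lightness and heaviness *)

Section hazard_real.
Context (R : realType) (d : measure_display) (T : measurableType d).
Context (P : probability T R).
Implicit Types (X : {RV P >-> R}) (H : R -> R).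

Definition real_hazard X (x : R) : R := - ln (fine (ccdf X x)).

Lemma ccdf_fin X x : ccdf X x \is a fin_num.
Proof. by apply: fin_num_measure. Qed.

Lemma ccdf_gt0 X x : right_unbounded X -> 0 < fine (ccdf X x).
Proof.
move=> uX; apply: fine_gt0; rewrite ltey_eq ccdf_fin andbT.
rewrite (_ : ccdf X x = P [set t | x < X t]) ?uX//.
rewrite /ccdf /distribution /pushforward; congr (P _).
by apply/seteqP; split => t /=; rewrite in_itv/= andbT.
Qed.

Lemma hazardE X x : right_unbounded X -> hazard X x = (real_hazard X x)%:E.
Proof.
move=> uX; rewrite /hazard /real_hazard -(fineK (ccdf_fin X x)) lne_EFin//.
exact: ccdf_gt0.
Qed.

Lemma real_hazard_ge0 X x : 0 <= real_hazard X x.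
Proof.
rewrite oppr_ge0 ln_le0// -lee_fin fineK ?ccdf_fin//.
exact: probability_le1.
Qed.

Lemma real_hazard_nd X : right_unbounded X -> {homo real_hazard X : x y / x <= y}.
Proof.
move=> uX x y xy; rewrite lerN2 ler_ln ?posrE ?ccdf_gt0//.
by rewrite fine_le ?ccdf_fin// ccdf_nonincreasing.
Qed.

Lemma real_hazard_rc X : right_unbounded X -> right_continuous (real_hazard X).
Proof.
move=> uX x; apply: cvgN; apply: (@cvg_comp _ _ _ (fun y => fine (ccdf X y)) (@ln R)).
  2: by apply: continuous_ln; exact: ccdf_gt0.
by apply: fine_cvg; rewrite fineK ?ccdf_fin//; exact: ccdf_right_continuous.
Qed.

(** Stated for the limit inferior itself, because both lightness and, by
    negation, heaviness are read off from it.  The points where [H] vanishes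
    are avoided by going far enough to the right. *)
Lemma liminf_gt0P X H : cumulative_hazard H -> right_unbounded X ->
  (0 < liminf_hazard_ratio X H)%E <->
  exists g A, 0 < g /\ forall x, A <= x -> g * H x <= real_hazard X x.
Proof.
move=> hH uX; have /cvgryPgt/(_ 0)[B [_ HB]] := cumulative_hazardy hH.
rewrite /liminf_hazard_ratio limf_einfE; split.
  move=> /ereal_sup_gt[/= _ [V [A [_ HA]] <-]] h.
  have [g [g0 hg]] : exists g : R, 0 < g /\ forall x, V x ->
      (g%:E <= hazard X x / (H x)%:E)%E.
    have hm x : V x -> (ereal_inf [set hazard X x / (H x)%:E | x in V]
        <= hazard X x / (H x)%:E)%E.
      by move=> Vx; apply: ereal_inf_lbound; exists x.
    move: h hm; case: (ereal_inf _) => [g||]//.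
      by rewrite lte_fin => g0 hg; exists g.
    by move=> _ hm; exists 1; split => // x /hm; apply: le_trans; rewrite leey.
  exists g, (Num.max A B + 1); split => // x.
  rewrite addrC -lerBrDl => xAB.
  have /andP[xA xB] : (A < x) && (B < x).
    by rewrite -gt_max (le_lt_trans xAB)// ltrBlDr ltrDl.
  have := hg x (HA _ xA).
  rewrite hazardE// inver gt_eqF ?(HB _ xB)// lee_pdivlMr ?(HB _ xB)//.
move=> [g [A [g0 hg]]].
apply: (@lt_le_trans _ _ g%:E); first by rewrite lte_fin.
apply: le_ereal_sup_tmp.
exists (ereal_inf [set (hazard X x / (H x)%:E)%E |
  x in [set y : R | Num.max A B < y]]).
  exists [set y : R | Num.max A B < y] => //.
  by exists (Num.max A B); split => //; exact: num_real.
apply: le_ereal_inf_tmp => _ [x /=] + <-; rewrite gt_max => /andP[xA xB].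
rewrite hazardE// inver gt_eqF ?(HB _ xB)// lee_pdivlMr ?(HB _ xB)//.
by rewrite lee_fin hg// ltW.
Qed.

Lemma lightP X H : cumulative_hazard H -> right_unbounded X ->
  light H X <->
  exists g A, 0 < g /\ forall x, A <= x -> g * H x <= real_hazard X x.
Proof. by move=> hH uX; rewrite -liminf_gt0P//; split => [[]|]. Qed.

Lemma heavyP X H : cumulative_hazard H -> right_unbounded X ->
  heavy H X <->
  forall g A, 0 < g -> exists2 x, A <= x & real_hazard X x < g * H x.
Proof.
move=> hH uX.
have ge0 : (0 <= liminf_hazard_ratio X H)%E.
  rewrite /liminf_hazard_ratio limf_einfE; apply: le_ereal_sup_tmp.
  exists (ereal_inf [set hazard X x / (H x)%:E | x in setT])%E.
    by exists setT => //; exact: filterT.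
  apply: le_ereal_inf_tmp => _ [x _ <-].
  by rewrite hazardE// mule_ge0// ?inve_ge0// lee_fin ?real_hazard_ge0//
    (cumulative_hazard_ge0 hH).
split.
  move=> [_ h0] g A g0; apply: contrapT => hn.
  suff : (0 < liminf_hazard_ratio X H)%E by rewrite h0 ltxx.
  apply/liminf_gt0P => //; exists g, A; split => // x Ax.
  by rewrite leNgt; apply/negP => h; apply: hn; exists x.
move=> h; split => //; apply/eqP; rewrite eq_le ge0 andbT leNgt.
apply/negP => /(liminf_gt0P hH uX)[g [A [g0 hg]]].
by have [x /hg] := h g A g0; rewrite leNgt => /negP.
Qed.

End hazard_real.

(** * The hazard of a minimum of independent variables *)

Section minimum.
Context (R : realType) (d : measure_display) (T : measurableType d).
Context (P : probability T R) (I : finType).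
Variable X : I -> {RV P >-> R}.

Lemma lt_min_RV (J : {set I}) (t : T) (x : R) : (0 < #|J|)%N ->
  (x < min_RV X J t) = [forall i in J, x < X i t].
Proof.
move=> /card_gt0P[i0 i0J]; rewrite /min_RV.
have fin : \big[mine/+oo%E]_(i in J) (X i t)%:E \is a fin_num.
  rewrite fin_numElt; apply/andP; split.
    by apply: lt_bigmin => [|i _]; rewrite ?ltNyr.
  apply: (@le_lt_trans _ _ (X i0 t)%:E); last exact: ltry.
  exact: (bigmin_le_cond _ (fun i => (X i t)%:E) i0J).
rewrite -lte_fin fineK//; apply/idP/forall_inP => [h i iJ|h].
  by rewrite -lte_fin (lt_le_trans h)// bigmin_le_cond.
by apply: lt_bigmin => [|i iJ]; rewrite ?ltry// lte_fin h.
Qed.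

Hypothesis uX : forall i, right_unbounded (X i).
Hypothesis indep : mutually_independent X.

Lemma ccdf_min_RV (J : {set I}) (x : R) : (0 < #|J|)%N ->
  ccdf (min_RV X J : {RV P >-> R}) x = (\prod_(i in J) ccdf (X i) x)%E.
Proof.
move=> J0; rewrite /ccdf /distribution /pushforward/=.
rewrite -(@indep J (fun=> `]x, +oo[%classic))//.
congr (P _); apply/seteqP; split => t /=.
  rewrite in_itv/= andbT lt_min_RV// => /forall_inP h i /= iJ.
  by rewrite /preimage/= in_itv/= andbT h.
move=> h; rewrite in_itv/= andbT lt_min_RV//; apply/forall_inP => i iJ.
by have := h i iJ; rewrite /preimage/= in_itv/= andbT.
Qed.

Lemma fine_ccdf_min_RV (J : {set I}) (x : R) : (0 < #|J|)%N ->
  fine (ccdf (min_RV X J : {RV P >-> R}) x) = \prod_(i in J) fine (ccdf (X i) x).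
Proof.
move=> J0; rewrite ccdf_min_RV//.
rewrite (eq_bigr (fun i => (fine (ccdf (X i) x))%:E)); last first.
  by move=> i _; rewrite fineK// ccdf_fin.
by rewrite prodEFin.
Qed.

Lemma right_unbounded_min_RV (J : {set I}) : (0 < #|J|)%N ->
  right_unbounded (min_RV X J : {RV P >-> R}).
Proof.
move=> J0 x.
rewrite (_ : [set t | _] = (min_RV X J) @^-1` `]x, +oo[); last first.
  by apply/seteqP; split => t /=; rewrite in_itv/= andbT.
rewrite -[X in (_ < X)%E]/(ccdf (min_RV X J : {RV P >-> R}) x).
rewrite -(fineK (ccdf_fin _ _)) lte_fin fine_ccdf_min_RV//.
by apply: prodr_gt0 => i _; exact: ccdf_gt0.
Qed.

Lemma real_hazard_min_RV (J : {set I}) (x : R) : (0 < #|J|)%N ->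
  real_hazard (min_RV X J : {RV P >-> R}) x = \sum_(i in J) real_hazard (X i) x.
Proof.
move=> J0; rewrite /real_hazard fine_ccdf_min_RV//.
have pos i : 0 < fine (ccdf (X i) x) by exact: ccdf_gt0.
suff : ln (\prod_(i in J) fine (ccdf (X i) x)) =
    \sum_(i in J) ln (fine (ccdf (X i) x)) /\
  0 < \prod_(i in J) fine (ccdf (X i) x) by case=> -> _; rewrite sumrN.
elim/big_rec2 : _ => [|i y1 y2 _ [<- y10]]; first by rewrite ln1.
by rewrite lnM ?posrE// mulr_gt0.
Qed.

End minimum.

(** * Left limits and right-continuity *)

Section left_limit.
Context (R : realType) (H : R -> R) (Hnd : {homo H : x y / x <= y}).

Lemma left_limit_is_cvg s : cvg (H x @[x --> s^'-]).
Proof.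
apply: nondecreasing_at_left_is_cvgr.
  by near=> y => u v _ _; exact: Hnd.
near=> y; exists (H s) => _ [x /= + <-].
by rewrite in_itv/= => /andP[_ /ltW]; exact: Hnd.
Unshelve. all: by end_near. Qed.

Lemma left_limit_le s c : (forall x, x < s -> H x <= c) -> left_limit H s <= c.
Proof.
move=> h; apply: limr_le; first exact: left_limit_is_cvg.
by near=> x; exact: h.
Unshelve. all: by end_near. Qed.

Lemma le_left_limit s x : x < s -> H x <= left_limit H s.
Proof.
move=> xs; apply: limr_ge; first exact: left_limit_is_cvg.
by near=> y; apply: Hnd; near: y; apply: nbhs_left_ge.
Unshelve. all: by end_near. Qed.

End left_limit.

Lemma right_continuous_le (R : realType) (f g : R -> R) (s t : R) :
  right_continuous f -> right_continuous g -> s < t ->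
  (forall x, s < x <= t -> f x <= g x) -> f s <= g s.
Proof.
move=> fc gc st h; apply: ler_cvg_to (fc s) (gc s) _.
near=> x; apply: h; apply/andP; split => //.
by near: x; apply: nbhs_right_le.
Unshelve. all: by end_near. Qed.

Lemma right_continuous_lt (R : realType) (f g : R -> R) (t : R) :
  right_continuous f -> right_continuous g -> f t < g t ->
  exists2 u, t < u & forall x, t <= x <= u -> f x < g x.
Proof.
move=> fc gc ft.
have : \forall x \near t^'+, f x < g x.
  pose m := (f t + g t) / 2.
  have : \forall x \near t^'+, f x < m.
    by apply: (cvgr_lt (f t) (fc t)); rewrite /m; lra.
  have : \forall x \near t^'+, m < g x.
    by apply: (cvgr_gt (g t) (gc t)); rewrite /m; lra.
  by apply: filterS2 => x h1 h2; exact: lt_trans h2 h1.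
move=> [e /= e0 he]; exists (t + e / 2); first by rewrite ltrDl divr_gt0.
move=> x /andP[]; rewrite le_eqVlt => /predU1P[<- //|tx] xe.
apply: he => //=; rewrite ltr_norml; apply/andP; split; lra.
Qed.

(** * Extracting a segmentation from two competing hazards *)

(** Here [a] stands for the hazard of the distinguished variable and [b] for
    the sum of the hazards of [k - 1] other ones.  Together they carry [U],
    while [b] alone is heavy. *)
Section segmentation_of_pair.
Context (R : realType) (D U : R -> R).
Hypotheses (hD : cumulative_hazard D) (hU : cumulative_hazard U).
Context (x0 : R) (hle : forall x, x0 <= x -> D x <= U x).
Context (a b : R -> R).
Hypotheses (a_rc : right_continuous a) (b_nd : {homo b : x y / x <= y}).
Context (g A : R) (g0 : 0 < g) (hg : forall x, A <= x -> g * U x <= a x + b x).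
Hypothesis hb : forall e B, 0 < e -> exists2 x, B <= x & b x < e * D x.

(** The segment ends just after a point [t] where [b] is negligible, and
    starts at the supremum [s] of the points before [t] at which [a] fails to
    carry [U], or at [B] if there are none.  At such points, which accumulate
    at [s] from the left, [U] is at most a constant times [b], hence times
    [b t]. *)
Lemma segment_step B e : x0 <= B -> A <= B -> 0 < U B -> 0 < e ->
  exists s t, [/\ B <= s, s < t, left_limit U s <= e * D t &
    forall x, s <= x <= t -> g / 4 * U x <= a x].
Proof.
move=> x0B AB UB e0; pose h := g / 2; have h0 : 0 < h by rewrite divr_gt0.
have Upos x : B <= x -> 0 < U x.
  by move=> Bx; apply: lt_le_trans UB _; exact: cumulative_hazard_nd hU _ _ Bx.
have /cvgryPge/(_ (U B / e))[B' [_ hB']] := cumulative_hazardy hD.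
(* beyond [B'], [D] dominates [U B / e], which settles the case [s = B] *)
pose B1 := Num.max B (B' + 1).
have he0 : 0 < Num.min h (h * e) by rewrite lt_min h0 mulr_gt0.
have [t] := hb B1 he0.
rewrite ge_max => /andP[Bt B't] bt.
have Dt : U B / e <= D t by apply: hB'; lra.
have Dt0 : 0 < D t by apply: lt_le_trans Dt; rewrite divr_gt0.
have bh : b t < h * D t.
  by apply: (lt_le_trans bt); rewrite ler_pM2r// ge_min lexx.
have bhe : b t < h * e * D t.
  by apply: (lt_le_trans bt); rewrite ler_pM2r// ge_min lexx orbT.
have at_ : h * U t <= a t.
  have := hg (le_trans AB Bt).
  have : h * D t <= h * U t by rewrite ler_pM2l//; exact: hle (le_trans x0B Bt).
  by move: bh; rewrite /h; lra.
(* [B] is put into the set so that its supremum also covers the case where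
   [a] carries [U] on all of [B, t] *)
pose S : set R := [set x | x = B \/ [/\ B <= x, x <= t & a x < h * U x]].
have SU x : S x -> U x <= e * D t.
  case=> [->|[Bx xt ax]]; first by rewrite mulrC -ler_pdivrMr.
  have := hg (le_trans AB Bx); have := b_nd xt => b1 b2.
  rewrite -(ler_pM2l h0) mulrA; apply/ltW; apply: le_lt_trans bhe.
  by apply: le_trans b1; move: b2 ax; rewrite /h; lra.
have Sle x : S x -> x <= t by case=> [->|[]].
have hsS : has_sup S.
  by split; [exists B; left|exists t => x; exact: Sle].
pose s := sup S.
have Bs : B <= s by apply: sup_upper_bound => //; left.
have st : s <= t by apply: ge_sup => //; exists B; left.
have oc x : s < x <= t -> h * U x <= a x.
  move=> /andP[sx xt]; rewrite leNgt; apply/negP => ax.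
  have : S x by right; split => //; exact: le_trans Bs (ltW sx).
  by move/(sup_upper_bound hsS); rewrite leNgt sx.
have hUrc c : right_continuous (fun x => c * U x).
  by move=> x; apply: cvgM; [exact: cvg_cst|exact: cumulative_hazard_rc hU _].
have cc x : s <= x <= t -> h * U x <= a x.
  move=> /andP[]; rewrite le_eqVlt => /predU1P[<- _|sx xt]; last first.
    by apply: oc; rewrite sx.
  move: st; rewrite le_eqVlt => /predU1P[->//|st].
  exact: (right_continuous_le (hUrc h) a_rc st oc).
(* halving the constant makes the inequality at [t] strict, so that it persists
   to the right of [t] and the segment is nondegenerate even if [s = t] *)
have lt_at : g / 4 * U t < a t.
  by have := mulr_gt0 g0 (Upos _ Bt); move: at_; rewrite /h; lra.
have [t' tt' ht'] := right_continuous_lt (hUrc (g / 4)) a_rc lt_at.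
exists s, t'; split => //.
- exact: le_lt_trans st tt'.
- apply: left_limit_le => [|x xs]; first exact: cumulative_hazard_nd hU.
  have [y Sy xy] := sup_gt (ex_intro _ B (or_introl erefl)) xs.
  apply: (@le_trans _ _ (U y)).
    exact: cumulative_hazard_nd hU _ _ (ltW xy).
  apply: (le_trans (SU y Sy)); rewrite ler_pM2l//.
  exact: cumulative_hazard_nd hD _ _ (ltW tt').
- move=> x /andP[sx xt']; have [xt|tx] := leP x t.
    have := cc x; rewrite sx xt => /(_ erefl); apply: le_trans.
    apply: ler_wpM2r; first exact: ltW (Upos _ (le_trans Bs sx)).
    by move: g0; rewrite /h; lra.
  by apply/ltW/ht'; rewrite (ltW tx).
Qed.

Lemma segmentation_of_pair : exists gamma s t, [/\ 0 < gamma,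
  segmentation D U s t &
  forall (i : nat) x, s i <= x <= t i -> 0 < U x /\ gamma * U x <= a x].
Proof.
have /cvgryPgt/(_ 1)[B1 [_ hB1]] := cumulative_hazardy hD.
pose B0 := Num.max (Num.max x0 A) (B1 + 1).
have B0x : x0 <= B0 by rewrite !le_max lexx.
have B0A : A <= B0 by rewrite !le_max lexx !orbT.
have B0D : 1 < D B0 by apply: hB1; rewrite lt_max ltrDl ltr01 orbT.
have Upos x : B0 <= x -> 0 < U x.
  move=> Bx; apply: (@lt_le_trans _ _ (D x)).
    apply: lt_trans ltr01 (lt_le_trans B0D _).
    exact: cumulative_hazard_nd hD _ _ Bx.
  exact: hle (le_trans B0x Bx).
have /choice[F hF] : forall p : R * R, exists q : R * R,
    B0 <= p.1 -> 0 < p.2 ->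
    [/\ p.1 <= q.1, q.1 < q.2, left_limit U q.1 <= p.2 * D q.2 &
    forall x, q.1 <= x <= q.2 -> g / 4 * U x <= a x].
  move=> [B e]; have [/= h|h] := pselect (B0 <= B /\ 0 < e); last first.
    by exists (0, 0) => ? ?; exfalso; apply: h.
  have [s [t st]] := segment_step (le_trans B0x h.1) (le_trans B0A h.1)
    (Upos _ h.1) h.2.
  by exists (s, t).
pose q := fix q i := if i is j.+1 then F ((q j).2 + 1, j.+2%:R^-1) else F (B0, 1).
have hq i : B0 <= (q i).1 /\ [/\ (q i).1 < (q i).2,
   left_limit U (q i).1 <= i.+1%:R^-1 * D (q i).2 &
   forall x, (q i).1 <= x <= (q i).2 -> g / 4 * U x <= a x].
  elim: i => [|i [IH1 [IH2 IH3 IH4]]] /=.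
    by have [] := hF (B0, 1) (lexx _) ltr01; rewrite /= invr1.
  have [||] := hF ((q i).2 + 1, i.+2%:R^-1) => //=.
    by rewrite (le_trans IH1)// (le_trans (ltW IH2))// lerDl.
  move=> h1 h2 h3 h4; split => //.
  by apply: le_trans h1; rewrite (le_trans IH1)// (le_trans (ltW IH2))// lerDl.
have Dpos i : 0 < D (q i).2.
  apply: (lt_trans ltr01); apply: (lt_le_trans B0D).
  apply: (cumulative_hazard_nd hD); apply: (le_trans (hq i).1).
  by have [_ [/ltW]] := hq i.
exists (g / 4), (fun i => (q i).1), (fun i => (q i).2); split.
- by rewrite divr_gt0.
- split.
  + by move=> i; have [_ []] := hq i.
  + move=> i /=.
    have [h0 [h2 _ _]] := hq i.
    have [||] := hF ((q i).2 + 1, i.+2%:R^-1) => //=.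
      by rewrite (le_trans h0)// (le_trans (ltW h2))// lerDl.
    by move=> h1 _ _ _; apply: lt_le_trans h1; rewrite ltrDl.
  + by apply: (lt_le_trans B0D); apply: (cumulative_hazard_nd hD); exact: (hq 0%N).1.
  + apply: (@squeeze_cvgr _ _ _ _ (fun=> 0) (fun i => i.+1%:R^-1)).
    * near=> i; apply/andP; split.
        rewrite divr_ge0// ?(ltW (Dpos i))//.
        apply: (@le_trans _ _ (U ((q i).1 - 1))).
          exact: (cumulative_hazard_ge0 hU).
        by apply: le_left_limit; [exact: (cumulative_hazard_nd hU)|lra].
      by rewrite ler_pdivrMr//; have [_ []] := hq i.
    * exact: cvg_cst.
    * exact: cvg_harmonic.
- move=> i x /[dup] /andP[sx _] xi; split; first exact: Upos (le_trans (hq i).1 sx).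
  by have [_ [_ _]] := hq i; exact.
Unshelve. all: by end_near. Qed.

End segmentation_of_pair.

(** * Flattening a cumulative hazard on a sequence of intervals *)

Section flattening.
Context (R : realType) (U : R -> R) (hU : cumulative_hazard U).
Context (a b : nat -> R).
Hypothesis a_nd : forall i, a i <= a i.+1.
Hypothesis ab : forall i, a i <= b i.
Hypothesis ba : forall i, b i <= a i.+1.
Hypothesis a_unbounded : forall B, exists i, B <= a i.

Let U_nd : {homo U : x y / x <= y} := cumulative_hazard_nd hU.

Let a_le i j : (i <= j)%N -> a i <= a j.
Proof. by move=> ij; have /nondecreasing_seqP := a_nd; apply. Qed.

Let m i := left_limit U (a i).

Let m_le i j : (i <= j)%N -> m i <= m j.
Proof.
move=> ij; apply: left_limit_le => // x xi; apply: le_left_limit => //.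
exact: lt_le_trans xi (a_le ij).
Qed.

Lemma next_block_subproof x : exists i, x < b i.
Proof.
have [i xi] := a_unbounded (x + 1); exists i.
by apply: lt_le_trans (ab i); lra.
Qed.

(** The first block that ends after [x]: either it contains [x], or [x] lies in
    the gap before it. *)
Definition next_block x : nat := ex_minn (next_block_subproof x).

(** The function equal to the constant [U (a i - 0)] on each interval
    [a i, b i[ and to [U] elsewhere.  In a gap before [a i], the cap
    [U (a i - 0)] has no effect since [U] has not reached it yet; taking the
    minimum therefore avoids a case distinction and makes monotonicity and
    right-continuity direct. *)
Definition flatten x : R := Num.min (U x) (left_limit U (a (next_block x))).

Lemma flatten_le i x : x < b i -> flatten x <= left_limit U (a i).
Proof.
move=> xi; rewrite /flatten /next_block; case: ex_minnP => j _ /(_ _ xi) ji.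
by rewrite ge_min [X in _ || X](m_le ji) orbT.
Qed.

Lemma flatten_id x : (forall i, a i <= x -> b i <= x) -> flatten x = U x.
Proof.
move=> h; rewrite /flatten /next_block; case: ex_minnP => i xi _.
apply: min_idPl; apply: le_left_limit => //.
by rewrite ltNge; apply/negP => /h; rewrite leNgt xi.
Qed.

Lemma next_block_nd x y : x <= y -> (next_block x <= next_block y)%N.
Proof.
move=> xy; rewrite /next_block; case: ex_minnP => i _ hi; case: ex_minnP => j yj _.
by apply: hi; exact: le_lt_trans xy yj.
Qed.

Lemma next_block_ge n x : a n <= x -> (n <= next_block x)%N.
Proof.
move=> nx; rewrite /next_block; case: ex_minnP => i xi _; rewrite leqNgt.
apply/negP => /a_le h; move: xi; rewrite ltNge => /negP; apply.
exact: le_trans (le_trans (ba i) h) nx.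
Qed.

(** To the right of [x] the next block does not change at once, so [flatten]
    is there the minimum of [U] and a constant; it diverges because the caps
    [U (a i - 0)] do. *)
Lemma flatten_cumulative_hazard : cumulative_hazard flatten.
Proof.
have f0 x : 0 <= flatten x.
  rewrite le_min (cumulative_hazard_ge0 hU)/=.
  apply: (@le_trans _ _ (U (a (next_block x) - 1))).
    exact: cumulative_hazard_ge0 hU _.
  by apply: le_left_limit => //; lra.
split => //.
- move=> x y xy; rewrite /flatten le_min !ge_min U_nd//=.
  by rewrite [X in _ || X](m_le (next_block_nd xy)) orbT.
- move=> x; have xb : x < b (next_block x).
    by rewrite /next_block; case: ex_minnP.
  have nE y : x <= y -> y < b (next_block x) -> next_block y = next_block x.
    move=> xy yb; apply/eqP; rewrite eqn_leq (next_block_nd xy) andbT.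
    by rewrite {1}/next_block; case: ex_minnP => j _; apply.
  apply: cvg_trans (_ : Num.min (U y) (m (next_block x)) @[y --> x^'+] --> _).
    apply: near_eq_cvg; near=> y; rewrite /flatten nE//.
  rewrite /flatten minr_absE; under eq_fun do rewrite minr_absE.
  have Ux : U y @[y --> x^'+] --> U x by exact: (cumulative_hazard_rc hU).
  apply: cvgM; last exact: cvg_cst.
  apply: cvgB; first by apply: cvgD; [exact: Ux|exact: cvg_cst].
  by apply: cvg_norm; apply: cvgB; [exact: Ux|exact: cvg_cst].
- apply: (@squeeze_cvgr _ _ _ _ (fun=> 0) U).
  + by near=> x; rewrite f0 /flatten ge_min lexx.
  + exact: cvg_cst.
  + exact: cumulative_hazardNy hU.
- apply/cvgryPge => M.
  have /cvgryPge/(_ M)[B [_ hB]] := cumulative_hazardy hU.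
  have [i Bi] := a_unbounded (B + 2).
  near=> x; have ix : a i <= x by near: x; apply: nbhs_pinfty_ge; exact: num_real.
  have Bx : B < x by apply: lt_le_trans ix; lra.
  rewrite /flatten le_min hB//=.
  apply: (@le_trans _ _ (U (B + 1))); first by apply: hB; rewrite ltrDl.
  apply: (@le_trans _ _ (m i)); first by apply: le_left_limit => //; lra.
  exact: (m_le (next_block_ge ix)).
Unshelve. all: by end_near. Qed.

End flattening.

(** * Blocks: thinned segments together with heavy points of the first hazard *)

(** Block [i] is [s i, s i.+1[.  On [s i, u i] the hazard [a] carries [U]; the
    point [t i] is strictly inside this segment, so that a function flattened on
    [s i, u i[ is still flat at [t i]; in the gap after [u i], [y i] is a point
    where [a] is negligible before [D]. *)
Record block_sequence (R : realType) (D U a : R -> R) (g : R)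
    (s t u y : nat -> R) : Prop := {
  block_gt1 : forall i, 1 < D (s i) ;
  block_ge : forall i, i%:R <= s i ;
  block_st : forall i, s i < t i ;
  block_tu : forall i, t i < u i ;
  block_uy : forall i, u i <= y i ;
  block_yS : forall i, y i < s i.+1 ;
  block_left_limit : forall i, left_limit U (s i) <= i.+1%:R^-1 * D (t i) ;
  block_heavy : forall i, a (y i) < i.+1%:R^-1 * D (y i) ;
  block_large : forall i x, s i <= x <= u i -> g * U x <= a x
}.

Section refine_segmentation.
Context (R : realType) (D U : R -> R).
Hypotheses (hD : cumulative_hazard D) (hU : cumulative_hazard U).
Context (a : R -> R) (a_rc : right_continuous a).
Hypothesis ha : forall e B, 0 < e -> exists2 x, B <= x & a x < e * D x.
Context (gamma : R) (s t : nat -> R) (gamma0 : 0 < gamma).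
Hypothesis st : segmentation D U s t.
Hypothesis hs : forall i x, s i <= x <= t i -> 0 < U x /\ gamma * U x <= a x.

Lemma segmentation_le i j : (i <= j)%N -> s i <= s j.
Proof.
move=> ij; suff /nondecreasing_seqP : forall i, s i <= s i.+1 by apply.
move=> l; exact: ltW (lt_trans (segmentation_lt st l) (segmentation_ltS st l)).
Qed.

(** Were the segments bounded, [D (t i)] would be bounded, whereas
    [U (s i - 0)] stays above [U (s 0)], which is positive by [hs]; their
    quotient could not tend to [0]. *)
Lemma segmentation_unbounded B : exists N, forall i, (N <= i)%N -> B <= s i.
Proof.
apply: contrapT => /forallNP h.
have sB i : s i < B.
  have /existsNP[j /not_implyP[ij /negP]] := h i; rewrite -ltNge.
  by apply: le_lt_trans; exact: segmentation_le.
have D1 i : 1 < D (t i).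
  apply: (lt_le_trans (segmentation_gt1 st)); apply: cumulative_hazard_nd hD _ _ _.
  exact: le_trans (segmentation_le (leq0n i)) (ltW (segmentation_lt st i)).
have DB i : D (t i) <= D B.
  apply: cumulative_hazard_nd hD _ _ _.
  exact: ltW (lt_trans (segmentation_ltS st i) (sB i.+1)).
have DB0 : 0 < D B by apply: lt_le_trans (DB 0%N); exact: lt_trans ltr01 (D1 _).
have U0 : 0 < U (s 0%N).
  by have [] := hs (i := 0) (x := s 0%N); rewrite ?lexx ?(ltW (segmentation_lt st 0)).
have e0 : 0 < U (s 0%N) / D B by rewrite divr_gt0.
have /cvgr_lt/(_ _ e0)[N _ hN] := segmentation_cvg st.
have := hN N.+1 (leqnSn N); rewrite ltNge => /negP; apply.
apply: (@le_trans _ _ (left_limit U (s N.+1) / D B)); last first.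
  rewrite ler_pM2l ?lef_pV2 ?posrE ?(lt_trans ltr01 (D1 _))//.
  apply: (lt_le_trans U0); apply: le_left_limit; first exact: cumulative_hazard_nd hU.
  apply: le_lt_trans (lt_trans (segmentation_lt st N) (segmentation_ltS st N)).
  exact: segmentation_le.
rewrite ler_pM2r ?invr_gt0//; apply: le_left_limit; first exact: cumulative_hazard_nd hU.
apply: le_lt_trans (lt_trans (segmentation_lt st N) (segmentation_ltS st N)).
exact: segmentation_le.
Qed.

(** The segment is extended a little beyond its right end by right-continuity,
    at the cost of half of [gamma]; heaviness of [a] then yields [y]. *)
Lemma refined_segment B e : 0 < e -> exists s' t' u y,
  [/\ B <= s' /\ 1 < D s', s' < t' /\ t' < u, u <= y,
      left_limit U s' <= e * D t' /\ a y < e * D y &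
      forall x, s' <= x <= u -> gamma / 2 * U x <= a x].
Proof.
move=> e0; have [N hN] := segmentation_unbounded B.
have /cvgr_lt/(_ _ e0)[N' _ hN'] := segmentation_cvg st.
pose i := maxn N N'.
have D1 : 1 < D (s i).
  apply: (lt_le_trans (segmentation_gt1 st)); apply: cumulative_hazard_nd hD _ _ _.
  exact: segmentation_le.
have D2 : 0 < D (t i).
  apply: lt_trans ltr01 (lt_le_trans D1 _); apply: cumulative_hazard_nd hD _ _ _.
  exact: ltW (segmentation_lt st i).
have [Ut at_] : 0 < U (t i) /\ gamma * U (t i) <= a (t i).
  by apply: (hs (i := i)); rewrite lexx (ltW (segmentation_lt st i)).
have Urc : right_continuous (fun x => gamma / 2 * U x).
  by move=> x; apply: cvgM; [exact: cvg_cst|exact: cumulative_hazard_rc hU _].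
have lt_at : gamma / 2 * U (t i) < a (t i).
  by apply: lt_le_trans at_; rewrite ltr_pM2r//; move: gamma0; lra.
have [u tu hu] := right_continuous_lt Urc a_rc lt_at.
have [y uy ay] := ha u e0.
exists (s i), (t i), u, y; split => //.
- by split => //; apply: hN; exact: leq_maxl.
- by split => //; exact: segmentation_lt st i.
- split => //; rewrite -ler_pdivrMr//; apply: ltW; apply: hN' => /=; exact: leq_maxr.
- move=> x /andP[sx xu]; have [xt|tx] := leP x (t i).
    have [] := hs (i := i) (x := x); first by rewrite sx.
    move=> Ux; apply: le_trans; rewrite ler_pM2r//; move: gamma0; lra.
  by apply/ltW/hu; rewrite (ltW tx).
Qed.

(** Blocks are chosen greedily: the next segment is one that starts after the
    last heavy point of [a], and the segments in between are dropped. *)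
Lemma block_sequence_of_segmentation : exists s' t' u y,
  block_sequence D U a (gamma / 2) s' t' u y.
Proof.
have /choice[F hF] : forall p : R * R, exists q : R * R * R * R,
    let: (s', t', u, y) := q in 0 < p.2 ->
    [/\ p.1 <= s' /\ 1 < D s', s' < t' /\ t' < u, u <= y,
      left_limit U s' <= p.2 * D t' /\ a y < p.2 * D y &
      forall x, s' <= x <= u -> gamma / 2 * U x <= a x].
  move=> [B e]; have [e0|] := ltP 0 e; last by exists (0, 0, 0, 0).
  have [s' [t' [u [y h]]]] := refined_segment B e0.
  by exists (s', t', u, y).
pose q := fix q i := if i is j.+1 then
   F (Num.max ((q j).2 + 1) (j.+1)%:R, j.+2%:R^-1) else F (0, 1).
have q1 i : exists2 B, i%:R <= B & q i = F (B, i.+1%:R^-1).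
  case: i => [|i]; first by exists 0; rewrite //= invr1.
  by exists (Num.max ((q i).2 + 1) i.+1%:R) => //; rewrite le_max lexx orbT.
have qS i : (q i).2 < (q i.+1).1.1.1.
  have := hF (Num.max ((q i).2 + 1) i.+1%:R, i.+2%:R^-1) => /=.
  case: (F _) => [[[s' t'] u] y]/=.
  rewrite invr_gt0 ltr0n => /(_ isT)[[+ _] _ _ _ _].
  by apply: lt_le_trans; rewrite lt_max ltrDl ltr01.
have qP i : [/\ i%:R <= (q i).1.1.1 /\ 1 < D (q i).1.1.1,
    (q i).1.1.1 < (q i).1.1.2 /\ (q i).1.1.2 < (q i).1.2, (q i).1.2 <= (q i).2,
    left_limit U (q i).1.1.1 <= i.+1%:R^-1 * D (q i).1.1.2 /\
    a (q i).2 < i.+1%:R^-1 * D (q i).2 &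
    forall x, (q i).1.1.1 <= x <= (q i).1.2 -> gamma / 2 * U x <= a x].
  have [B iB qE] := q1 i; have := hF (B, i.+1%:R^-1); rewrite -qE.
  case: (q i) => [[[s' t'] u] y]/=.
  rewrite invr_gt0 ltr0n => /(_ isT)[[Bs Ds] st' uy h1 h2]; split => //.
  by split => //; exact: le_trans iB Bs.
exists (fun i => (q i).1.1.1), (fun i => (q i).1.1.2), (fun i => (q i).1.2),
  (fun i => (q i).2).
by split => // i; have [[? ?] [? ?] ? [? ?] ?] := qP i.
Qed.

End refine_segmentation.

Lemma block_sequence_le (R : realType) (D U a : R -> R) (g g' : R)
    (s t u y : nat -> R) : (forall x, 0 <= U x) -> g' <= g ->
  block_sequence D U a g s t u y -> block_sequence D U a g' s t u y.
Proof.
move=> U0 gg [*]; split => // i x sxu.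
by apply: (@le_trans _ _ (g * U x)); [exact: ler_wpM2r|eauto].
Qed.

(** * Making every small set of hazards heavy in turn *)

Lemma infinitely_often_enumeration (n k : nat) : (0 < k)%N ->
  exists K : nat -> {set 'I_n}, (forall i, (#|K i| < k)%N) /\
  forall (S : {set 'I_n}) N, (#|S| < k)%N -> exists2 i, (N <= i)%N & K i = S.
Proof.
move=> k0; pose e := enum {set 'I_n}.
have e0 : (0 < size e)%N.
  have : (finset.set0 : {set 'I_n}) \in e by rewrite mem_enum.
  by case: (e).
pose L i := nth finset.set0 e (i %% size e).
exists (fun i => if (#|L i| < k)%N then L i else finset.set0); split.
  by move=> i; case: ifPn => // _; rewrite cards0.
move=> S N Sk; exists (N * size e + index S e)%N.
  by rewrite (leq_trans _ (leq_addr _ _))// leq_pmulr.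
have -> : L (N * size e + index S e)%N = S.
  have Se : S \in e by rewrite mem_enum.
  by rewrite /L modnMDl modn_small ?index_mem// nth_index.
by rewrite Sk.
Qed.

Section hazards_of_segmentation.
Context (R : realType) (D U : R -> R).
Hypotheses (hD : cumulative_hazard D) (hU : cumulative_hazard U).
Context (a : R -> R) (g : R) (g0 : 0 < g) (g1 : g <= 1).
Hypothesis a_ge0 : forall x, 0 <= a x.
Context (s t u y : nat -> R).
Hypothesis hs : block_sequence D U a g s t u y.
Context (n k : nat) (k1 : (1 < k)%N) (i1 : 'I_n).
Context (K : nat -> {set 'I_n}) (Kk : forall i, (#|K i| < k)%N).
Hypothesis Kinf : forall (S : {set 'I_n}) N, (#|S| < k)%N ->
  exists2 i, (N <= i)%N & K i = S.

(** In block [i], hazard [j] is flat from [s i] up to this point.  If the first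
    index is in [K i], the hazards of [K i] have to be small at [y i], in the
    gap; otherwise they have to be small at [t i], and must be large again in
    the gap, where the first hazard may be small too. *)
Definition flat_end (j : 'I_n) (i : nat) : R :=
  if j \in K i then if i1 \in K i then s i.+1 else u i else s i.

Let s_lt : forall i, s i < t i := block_st hs.
Let t_lt : forall i, t i < u i := block_tu hs.
Let u_le : forall i, u i <= y i := block_uy hs.
Let y_lt : forall i, y i < s i.+1 := block_yS hs.
Let u_lt i : u i < s i.+1. Proof. exact: le_lt_trans (u_le i) (y_lt i). Qed.
Let su i : s i < u i. Proof. exact: lt_trans (s_lt i) (t_lt i). Qed.
Let sS i : s i <= s i.+1. Proof. exact: ltW (lt_trans (su i) (u_lt i)). Qed.

Let s_le i j : (i <= j)%N -> s i <= s j.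
Proof. by move=> ij; have /nondecreasing_seqP := sS; apply. Qed.

Let s_unbounded B : exists i, B <= s i.
Proof.
exists (Num.truncn `|B|).+1; apply: le_trans (block_ge hs _).
by apply: le_trans (ler_norm B) _; apply/ltW/truncnS_gt.
Qed.

Let s_le_end j i : s i <= flat_end j i.
Proof. by rewrite /flat_end; case: ifPn => // _; case: ifPn => // _; exact: ltW. Qed.

Let end_le j i : flat_end j i <= s i.+1.
Proof. by rewrite /flat_end; case: ifPn => // _; case: ifPn => // _; exact: ltW. Qed.

Definition flat_hazard (j : 'I_n) : R -> R :=
  if j == i1 then a else flatten U (s_le_end j) s_unbounded.

Lemma flat_hazard_cumulative j : j != i1 -> cumulative_hazard (flat_hazard j).
Proof.
by move=> /negbTE ji; rewrite /flat_hazard ji; exact: flatten_cumulative_hazard.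
Qed.

Lemma flat_hazard_ge0 j x : 0 <= flat_hazard j x.
Proof.
have [->|ji] := eqVneq j i1; first by rewrite /flat_hazard eqxx.
exact: cumulative_hazard_ge0 (flat_hazard_cumulative ji) x.
Qed.

Lemma flat_hazard_id j i x : j != i1 -> s i <= x < s i.+1 -> flat_end j i <= x ->
  flat_hazard j x = U x.
Proof.
move=> /negbTE ji /andP[sx xs] ex; rewrite /flat_hazard ji flatten_id// => l lx.
have [li|il|->//] := ltngtP l i.
  exact: le_trans (end_le j l) (le_trans (s_le li) sx).
by move: (lt_le_trans xs (s_le il)); rewrite ltNge lx.
Qed.

Lemma block_exists x : s 0%N <= x -> exists i, s i <= x < s i.+1.
Proof.
move=> sx; have ex : exists i, x < s i.
  have [i xi] := s_unbounded (x + 1); exists i.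
  by apply: lt_le_trans xi; rewrite ltrDl.
case: (ex_minnP ex) => -[|i] xi hi; first by rewrite ltNge sx in xi.
exists i; rewrite xi andbT leNgt; apply/negP => /hi.
by rewrite ltnn.
Qed.

Lemma pick_outside (I S : {set 'I_n}) : (#|S| < #|I|)%N ->
  exists2 j, j \in I & j \notin S.
Proof.
move=> SI; have /subsetPn[j jI jS] : ~~ (I \subset S).
  by apply: contraTN SI => /subset_leq_card; rewrite -leqNgt.
by exists j.
Qed.

(** At a point of block [i], the small hazards are among those of [K i] or, in
    the gap when the first index is not in [K i], only the first one.  Either
    way there are fewer than [k] of them. *)
Lemma some_large (I : {set 'I_n}) x : #|I| = k -> s 0%N <= x ->
  exists2 j, j \in I & g * U x <= flat_hazard j x.
Proof.
move=> Ik /block_exists[i /andP[sx xs]].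
have large j : j \in I -> j != i1 -> flat_end j i <= x ->
    exists2 j, j \in I & g * U x <= flat_hazard j x.
  move=> jI ji ex; exists j => //; rewrite (flat_hazard_id (i := i))// ?sx//.
  by rewrite ler_piMl// (cumulative_hazard_ge0 hU).
have [j jI jK] : exists2 j, j \in I & j \notin K i by apply: pick_outside; rewrite Ik.
have ej : flat_end j i <= x by rewrite /flat_end (negbTE jK).
have [xu|ux] := ltP x (u i).
  have [i1I|i1I] := boolP (i1 \in I).
    exists i1 => //; rewrite /flat_hazard eqxx.
    by apply: (block_large hs (i := i)); rewrite sx ltW.
  by apply: (large j) => //; apply: contraNneq i1I => <-.
have [i1K|i1K] := boolP (i1 \in K i).
  by apply: (large j) => //; apply: contraNneq jK => ->.
have [l lI l1] : exists2 l, l \in I & l \notin [set i1]%SET.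
  by apply: pick_outside; rewrite cards1 Ik.
apply: (large l) => //; first by rewrite inE in l1.
by rewrite /flat_end (negbTE i1K); case: ifPn.
Qed.

Lemma flat_hazard_light (I : {set 'I_n}) x : #|I| = k -> s 0%N <= x ->
  g * U x <= \sum_(j in I) flat_hazard j x.
Proof.
move=> Ik /(some_large Ik)[j jI /le_trans]; apply.
rewrite (bigD1 j)//= lerDl; apply: sumr_ge0 => l _; exact: flat_hazard_ge0.
Qed.

Lemma flat_hazard_le j i x : j != i1 -> x < flat_end j i -> t i <= x ->
  flat_hazard j x <= i.+1%:R^-1 * D x.
Proof.
move=> /negbTE ji xe tx; rewrite /flat_hazard ji.
apply: le_trans; first exact: (flatten_le hU sS _ _ xe).
apply: (le_trans (block_left_limit hs i)).
by rewrite ler_pM2l// (cumulative_hazard_nd hD).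
Qed.

(** The common point is [y i] or [t i], according to whether the first index
    is in [I], for a block [i] with [K i = I]. *)
Lemma all_small (I : {set 'I_n}) N : (#|I| < k)%N -> exists i x,
  [/\ (N <= i)%N, s i <= x &
    forall j, j \in I -> flat_hazard j x <= i.+1%:R^-1 * D x].
Proof.
move=> Ik; have [i Ni KI] := Kinf N Ik.
have [i1I|i1I] := boolP (i1 \in I).
  have tyi : t i <= y i by apply: le_trans (ltW (t_lt i)) (u_le i).
  exists i, (y i); split => //; first exact: le_trans (ltW (s_lt i)) tyi.
  move=> j jI; have [->|ji] := eqVneq j i1.
    by rewrite /flat_hazard eqxx ltW// (block_heavy hs).
  by apply: flat_hazard_le => //; rewrite /flat_end KI jI i1I.
exists i, (t i); split => //; first exact: ltW.
move=> j jI; apply: flat_hazard_le => //; first by apply: contraNneq i1I => <-.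
by rewrite /flat_end KI jI (negbTE i1I).
Qed.

Lemma flat_hazard_heavy (I : {set 'I_n}) e B : (#|I| < k)%N -> 0 < e ->
  exists2 x, B <= x & \sum_(j in I) flat_hazard j x < e * D x.
Proof.
move=> Ik e0.
have [N hN] := s_unbounded B.
have [i [x [Ni sx hx]]] := all_small (maxn N (Num.truncn (n%:R / e))) Ik.
rewrite geq_max in Ni; case/andP: Ni => Ni Mi.
exists x.
  apply: le_trans sx; apply: le_trans (s_le Ni).
  exact: hN.
have D0 : 0 < D x.
  apply: lt_trans ltr01 (lt_le_trans (block_gt1 hs i) _).
  exact: cumulative_hazard_nd hD _ _ sx.
apply: (@le_lt_trans _ _ (\sum_(j in I) i.+1%:R^-1 * D x)); first exact: ler_sum.
(* at most [n] summands, and [n / i.+1 < e] by the choice of [i] *)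
rewrite sumr_const -[_ *+ #|I|]mulr_natl mulrA ltr_pM2r// ltr_pdivrMr//.
rewrite mulrC -ltr_pdivrMr//.
apply: (@le_lt_trans _ _ (n%:R / e)).
  by rewrite ler_pM2r ?invr_gt0// ler_nat -[leqRHS]card_ord max_card.
by apply: lt_le_trans (truncnS_gt _) _; rewrite ler_nat ltnS.
Qed.

End hazards_of_segmentation.

(** * Independent random variables with prescribed hazards *)

Section law_of_hazard.
Context (R : realType) (H : R -> R) (hH : cumulative_hazard H).

Definition cdf_of_hazard (x : R) := 1 - expR (- H x).

Lemma cdf_of_hazard_nd : nondecreasing cdf_of_hazard.
Proof.
by move=> x y xy; rewrite lerD2l lerN2 ler_expR lerN2 (cumulative_hazard_nd hH).
Qed.

Lemma cdf_of_hazard_rc : right_continuous cdf_of_hazard.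
Proof.
move=> x; apply: cvgB; first exact: cvg_cst.
apply: (@cvg_comp _ _ _ (fun y => - H y) (@expR R)); last exact: continuous_expR.
by apply: cvgN; exact: cumulative_hazard_rc hH x.
Qed.

Lemma cdf_of_hazardNy : cdf_of_hazard @ -oo --> (0 : R).
Proof.
rewrite [X in _ --> X](_ : _ = 1 - expR (- 0)); last by rewrite oppr0 expR0 subrr.
apply: cvgB; first exact: cvg_cst.
apply: (@cvg_comp _ _ _ (fun y => - H y) (@expR R)); last exact: continuous_expR.
by apply: cvgN; exact: cumulative_hazardNy hH.
Qed.

Lemma cdf_of_hazardy : cdf_of_hazard @ +oo --> (1 : R).
Proof.
rewrite [X in _ --> X](_ : _ = 1 - 0); last by rewrite subr0.
apply: cvgB; first exact: cvg_cst.
apply: (@cvg_comp _ _ _ H (fun y => expR (- y))); last exact: cvgr_expR.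
exact: cumulative_hazardy hH.
Qed.

Lemma law_of_hazard : exists mu : probability R R,
  forall x, mu `]x, +oo[%classic = (expR (- H x))%:E.
Proof.
pose F : cumulativeBounded (0 : R) (1 : R) := HB.pack cdf_of_hazard
  (isCumulative.Build R _ R cdf_of_hazard cdf_of_hazard_nd cdf_of_hazard_rc)
  (isCumulativeBounded.Build R 0 1 cdf_of_hazard cdf_of_hazardNy cdf_of_hazardy).
pose lsf : probability (measurableTypeR R) R := lebesgue_stieltjes_measure F.
(* [R] and [measurableTypeR R] have the same measurable sets but distinct
   measurable structures; pushing forward along the identity changes from one
   to the other *)
pose id_ : {RV lsf >-> R} := HB.pack (idfun : measurableTypeR R -> R)
  (isMeasurableFun.Build _ _ (measurableTypeR R) R idfun (@measurable_id _ _ setT)).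
exists (distribution lsf id_) => x.
have h : distribution lsf id_ `]-oo, x] = (cdf_of_hazard x)%:E.
  exact: cdf_lebesgue_stieltjes_id F x.
rewrite -setCitvl probability_setC//.
rewrite [X in (_ - X)%E](_ : _ = (cdf_of_hazard x)%:E)// -EFinB; congr (_%:E).
by rewrite /cdf_of_hazard; lra.
Qed.

End law_of_hazard.

(** Indices range over [nat] so that the induction adds the last coordinate
    without reindexing the previous ones. *)
Lemma independent_product (R : realType) (mu : nat -> probability R R) (n : nat) :
  exists (d : measure_display) (T : measurableType d) (P : probability T R)
    (X : nat -> {RV P >-> R}), forall A : nat -> set R,
    (forall i, measurable (A i)) ->
    P (\bigcap_(i < n) (X i @^-1` A i)) = (\prod_(i < n) mu i (A i))%E.
Proof.
elim: n => [|n [d [T [P [X IH]]]]].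
  exists _, R, (mu 0%N), (fun=> cst 0) => A mA.
  rewrite big_ord0 -[RHS](probability_setT (mu 0%N)); congr (mu 0%N _).
  by apply/seteqP; split.
exists _, (T * R)%type, (P \x mu n)%E.
have m1 i : measurable_fun setT (X i \o fst : T * R -> R).
  by apply: measurableT_comp => //; exact: measurable_fst.
have m2 : measurable_fun setT (snd : T * R -> R) by exact: measurable_snd.
pose Y1 i : {RV (P \x mu n)%E >-> R} := HB.pack (X i \o fst : T * R -> R)
  (isMeasurableFun.Build _ _ _ _ (X i \o fst : T * R -> R) (m1 i)).
pose Y2 : {RV (P \x mu n)%E >-> R} := HB.pack (snd : T * R -> R)
  (isMeasurableFun.Build _ _ _ _ (snd : T * R -> R) m2).
exists (fun i => if (i < n)%N then Y1 i else Y2) => A mA.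
rewrite big_ord_recr/= -IH// -product_measure1E//; last first.
  apply: bigcap_measurableType => i _; rewrite -[X in measurable X]setTI.
  exact: measurable_funP.
congr ((P \x mu n)%E _); apply/seteqP; split => -[x y] /=.
  move=> h; split => [i /= iltn|].
    by have := h i; rewrite /= iltn; apply; exact: ltnW.
  by have := h n; rewrite /= ltnn; apply.
move=> [h1 h2] i /=; rewrite ltnS leq_eqVlt => /predU1P[->|iltn].
  by rewrite ltnn.
by rewrite iltn; exact: h1.
Qed.

Lemma independent_family (R : realType) (n : nat) (mu : 'I_n -> probability R R) :
  exists (d : measure_display) (T : measurableType d) (P : probability T R)
    (X : 'I_n -> {RV P >-> R}), mutually_independent X /\
    forall i A, measurable A -> distribution P (X i) A = mu i A.
Proof.
pose nu (j : nat) : probability R R :=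
  if insub j is Some i then mu i else \d_(0 : R).
have nuE (i : 'I_n) : nu i = mu i by rewrite /nu valK.
have [d [T [P [X hX]]]] := independent_product nu n.
exists d, T, P, (fun i => X i).
(* the rectangle over [J] is the full rectangle whose other sides are [setT] *)
have joint (J : {set 'I_n}) (A : 'I_n -> set R) : (forall i, measurable (A i)) ->
    P (\bigcap_(i in [set` J]) (X i @^-1` A i)) = (\prod_(i in J) mu i (A i))%E.
  move=> mA.
  pose B (j : nat) : set R :=
    if insub j is Some i then if i \in J then A i else setT else setT.
  have BE (i : 'I_n) : B i = if i \in J then A i else setT by rewrite /B valK.
  have mB j : measurable (B j).
    by rewrite /B; case: insubP => // i _ _; case: ifPn.
  rewrite big_mkcond/= (eq_bigr (fun i : 'I_n => nu i (B i))); last first.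
    by move=> i _; rewrite nuE BE; case: ifPn => // _; rewrite probability_setT.
  rewrite -hX//; congr (P _); apply/seteqP; split => t h.
    move=> j /= jn; have -> : j = Ordinal jn by [].
    by rewrite /preimage/= (BE (Ordinal jn)); case: ifPn => // /h.
  by move=> i /= iJ; have := h i (ltn_ord i); rewrite /preimage/= BE iJ.
have marg i A : measurable A -> distribution P (X (nat_of_ord i)) A = mu i A.
  move=> mA; have := joint [set i]%SET (fun=> A) (fun=> mA).
  rewrite big_set1 => <-; congr (P _); apply/seteqP; split => t.
    by move=> h j /=; rewrite inE => /eqP ->.
  by move=> /(_ i); apply; rewrite /= inE.
split => // J A mA; rewrite joint//; apply: eq_bigr => i _.
by rewrite -marg.
Qed.

Lemma right_unbounded_of_ccdf (R : realType) (H : R -> R)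
    (d : measure_display) (T : measurableType d) (P : probability T R)
    (X : {RV P >-> R}) :
  (forall x, ccdf X x = (expR (- H x))%:E) ->
  right_unbounded X /\ forall x, real_hazard X x = H x.
Proof.
move=> h; split=> x; last by rewrite /real_hazard h/= expRK opprK.
rewrite (_ : [set t | _] = X @^-1` `]x, +oo[); last first.
  by apply/seteqP; split => t /=; rewrite in_itv/= andbT.
by rewrite -[X in (_ < X)%E]/(ccdf X x) h lte_fin expR_gt0.
Qed.

Lemma eq_distribution (R : realType) (d d' : measure_display)
    (T : measurableType d) (T' : measurableType d')
    (P : probability T R) (P' : probability T' R)
    (X : {RV P >-> R}) (X' : {RV P' >-> R}) :
  (forall A : set R, measurable A -> distribution P' X' A = distribution P X A) ->
  (forall x, real_hazard X' x = real_hazard X x) /\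
  (right_unbounded X <-> right_unbounded X').
Proof.
move=> h; have e x : ccdf X' x = ccdf X x by apply: h.
split=> [x|]; first by rewrite /real_hazard e.
have PE x : P [set t | x < X t] = P' [set t | x < X' t].
  have := e x; rewrite /ccdf /distribution /pushforward.
  rewrite (_ : X @^-1` _ = [set t | x < X t]); last first.
    by apply/seteqP; split => t /=; rewrite in_itv/= andbT.
  rewrite (_ : X' @^-1` _ = [set t | x < X' t])//.
  by apply/seteqP; split => t /=; rewrite in_itv/= andbT.
by split=> uX x; [rewrite -PE|rewrite PE].
Qed.

(** * The equivalence *)

Lemma card_subset_exists (n m : nat) (A : {set 'I_n}) : (m <= #|A|)%N ->
  exists2 B : {set 'I_n}, B \subset A & #|B| = m.
Proof.
move=> mA; exists [set x in take m (enum A)].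
  by apply/fintype.subsetP => x; rewrite inE => /mem_take; rewrite mem_enum.
rewrite cardsE (card_uniqP _) ?take_uniq ?enum_uniq//.
by rewrite size_take_min -cardE; apply/minn_idPl.
Qed.

Unset Implicit Arguments.
Set Strict Implicit.
Set Printing Implicit Defensive.

Theorem theorem1p11 (R : realType) (Hdown Hup : R -> R)
    (hdown : cumulative_hazard Hdown) (hup : cumulative_hazard Hup)
    (x0 : R) (hle : forall x : R, x0 <= x -> Hdown x <= Hup x)
    (d : measure_display) (T : measurableType d) (P : probability T R)
    (xi1 : {RV P >-> R}) (hxi1 : heavy Hdown xi1)
    (n k : nat) (hn : (1 < n)%N) (hk1 : (1 < k)%N) (hkn : (k <= n)%N) :
  (exists (d' : measure_display) (T' : measurableType d')
      (P' : probability T' R) (xi : 'I_n -> {RV P' >-> R}),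
    let i1 : 'I_n := Ordinal (ltnW hn) in
    [/\ forall A : set R, measurable A ->
          distribution P' (xi i1) A = distribution P xi1 A,
        forall i : 'I_n, i != i1 -> heavy Hdown (xi i),
        mutually_independent xi &
        forall I : {set 'I_n},
          (#|I| = k -> light Hup (min_RV xi I : {RV P' >-> R})) /\
          (#|I| = k.-1 -> heavy Hdown (min_RV xi I : {RV P' >-> R}))])
  <->
  (exists (gamma : R) (s t : nat -> R),
    [/\ 0 < gamma,
        segmentation Hdown Hup s t &
        forall (i : nat) (x : R), s i <= x <= t i ->
          0 < Hup x /\ (gamma%:E <= hazard xi1 x / (Hup x)%:E)%E]).
Proof.
have ux1 : right_unbounded xi1 by case: hxi1.
have k0 : (0 < k)%N by exact: ltnW.
have ratioE gamma x : 0 < Hup x ->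
    (gamma%:E <= hazard xi1 x / (Hup x)%:E)%E =
    (gamma * Hup x <= real_hazard xi1 x).
  by move=> U0; rewrite hazardE// inver gt_eqF// lee_pdivlMr.
split.
  move=> [d' [T' [P' [xi]]]].
  set i1 : 'I_n := Ordinal (ltnW hn) => -[distE hvy indep minE].
  have [rE uE] := eq_distribution distE.
  have uX i : right_unbounded (xi i).
    have [->|/hvy[]//] := eqVneq i i1; exact: (uE.1 ux1).
  have [J /fintype.subsetP J1 Jk] : exists2 J : {set 'I_n},
      J \subset ~: [set i1]%SET & #|J| = k.-1.
    by apply: card_subset_exists; rewrite cardsC1 card_ord; case: (k) (n) hkn => [|?] [].
  have i1J : i1 \notin J by apply/negP => /J1; rewrite !inE eqxx.
  have J0 : (0 < #|J|)%N by rewrite Jk -subn1 subn_gt0.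
  have Ik : #|i1 |: J| = k by rewrite cardsU1 i1J Jk add1n prednK.
  have I0 : (0 < #|i1 |: J|)%N by rewrite Ik.
  have [g [A [g0 hg]]] := (lightP hup (right_unbounded_min_RV uX indep I0)).1
    ((minE (i1 |: J)).1 Ik).
  have hb := (heavyP hdown (right_unbounded_min_RV uX indep J0)).1
    ((minE J).2 Jk).
  have [|x y xy|x Ax|e B e0|gamma [s [t [gamma0 st h]]]] :=
    @segmentation_of_pair R Hdown Hup hdown hup x0 hle (real_hazard xi1)
      (fun x => \sum_(j in J) real_hazard (xi j) x) _ _ g A g0.
  - exact: real_hazard_rc.
  - by apply: ler_sum => j _; exact: real_hazard_nd.
  - by have := hg x Ax; rewrite real_hazard_min_RV// big_setU1//= rE.
  - by have [x Bx] := hb e B e0; rewrite real_hazard_min_RV//; exists x.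
  - exists gamma, s, t; split => // i x /h[U0 hx]; split => //.
    by rewrite ratioE.
move=> [gamma [s [t [gamma0 st h]]]].
have hs i x : s i <= x <= t i ->
    0 < Hup x /\ gamma * Hup x <= real_hazard xi1 x.
  by move=> /h[U0]; rewrite ratioE.
have [s' [t' [u [y hstu0]]]] := block_sequence_of_segmentation hdown hup
  (real_hazard_rc ux1) ((heavyP hdown ux1).1 hxi1) gamma0 st hs.
set i1 : 'I_n := Ordinal (ltnW hn).
(* the hazards equal to [U] carry it with constant [1], so [g] is capped *)
pose g := Num.min (gamma / 2) 1.
have g0 : 0 < g by rewrite lt_min ltr01 divr_gt0.
have g1 : g <= 1 by rewrite ge_min lexx orbT.
have hstu : block_sequence Hdown Hup (real_hazard xi1) g s' t' u y.
  apply: block_sequence_le hstu0; first exact: (cumulative_hazard_ge0 hup).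
  by rewrite ge_min lexx.
have [K [Kk Kinf]] := infinitely_often_enumeration n k0.
pose r := flat_hazard hstu i1 K.
have r1 : r i1 = real_hazard xi1 by rewrite /r /flat_hazard eqxx.
have /choice[mu hmu] : forall i : 'I_n, exists mu : probability R R,
    (i = i1 -> mu = distribution P xi1) /\
    (i != i1 -> forall x, mu `]x, +oo[%classic = (expR (- r i x))%:E).
  move=> i; have [->|ii1] := eqVneq i i1; first by exists (distribution P xi1).
  have [mu hmu] := law_of_hazard (flat_hazard_cumulative hup hstu K ii1).
  by exists mu; split => // ie; rewrite ie eqxx in ii1.
have [d' [T' [P' [xi [indep hxi]]]]] := independent_family mu.
have distE A : measurable A ->
    distribution P' (xi i1) A = distribution P xi1 A.
  by move=> mA; rewrite hxi// (hmu i1).1.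
have rX i : right_unbounded (xi i) /\ forall x, real_hazard (xi i) x = r i x.
  have [->|ii1] := eqVneq i i1.
    have [rE uE] := eq_distribution distE.
    by split => [|x]; [exact: uE.1|rewrite rE r1].
  apply: right_unbounded_of_ccdf => x.
  by rewrite /ccdf hxi// (hmu i).2.
have uX i := (rX i).1.
have sumE (I : {set 'I_n}) x :
    \sum_(i in I) real_hazard (xi i) x = \sum_(i in I) r i x.
  by apply: eq_bigr => i _; exact: (rX i).2.
exists d', T', P', xi; split => //.
- move=> i ii1; apply/heavyP => // e B e0.
  have [|x Bx hx] := flat_hazard_heavy hdown hup hstu i1 Kinf
    (I := [set i]%SET) B _ e0.
    by rewrite cards1.
  by exists x => //; rewrite (rX i).2; rewrite big_set1 in hx.
- move=> I; split => Ik.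
    have I0 : (0 < #|I|)%N by rewrite Ik.
    apply/lightP => //; first exact: right_unbounded_min_RV.
    exists g, (s' 0%N); split => // x sx; rewrite real_hazard_min_RV// sumE.
    exact: (flat_hazard_light hup g1 (fun=> real_hazard_ge0 _ _) hstu hk1 i1
      Kk Ik sx).
  have I0 : (0 < #|I|)%N by rewrite Ik -subn1 subn_gt0.
  apply/heavyP => //; first exact: right_unbounded_min_RV.
  move=> e B e0.
  have [|x Bx hx] := flat_hazard_heavy hdown hup hstu i1 Kinf (I := I) B _ e0.
    by rewrite Ik prednK.
  by exists x => //; rewrite real_hazard_min_RV// sumE.
Qed.
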